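(* For integers $n \ge 1$ and $k \ge 0$, let $u(n,k)$ be the number of symmetric Dyck paths of semi-length $n$ with exactly $k$ valleys, and let $v(n,k) = N_{n,k}(-1)$ be the $q$-Narayana number evaluated at $q=-1$. Then $$u(n,k) = v(n,k) = \binom{\lfloor \frac{n-1}{2} \rfloor}{\lfloor \frac{k}{2} \rfloor}\binom{\lfloor \frac{n}{2} \rfloor}{\lfloor \frac{k+1}{2} \rfloor}.$$
   Context: A Dyck path of semi-length $n$ is a lattice path from $(0,0)$ to $(2n,0)$ consisting of $n$ up steps $U=(1,1)$ and $n$ down steps $D=(1,-1)$ that never goes below the $x$-axis. Writing the path by its heights $(p_0,p_1,\dots,p_{2n}) = (0,p_1,\dots,p_{2n-1},0)$, it is symmetric if $p_i = p_{2n-i}$ for all $0\le i\le n$. A valley is a point where a down step is immediately followed by an up step (a consecutive pair $DU$). For $q$-integers $[m]=[m]_q = \frac{1-q^m}{1-q}$, $[m]! = \prod_{j=1}^m [j]$, and $q$-binomial coefficients $\begin{bmatrix} n \\ k\end{bmatrix} = \frac{[n]!}{[k]![n-k]!}$ for $0\le k\le n$ (and $0$ otherwise), the $q$-Narayana numbers are $N_{n,k}(q) = \frac{1}{[k+1]}\begin{bmatrix} n \\ k\end{bmatrix}\begin{bmatrix} n-1 \\ k\end{bmatrix}$, which are polynomials in $q$; $N_{n,k}(-1)$ denotes evaluation of this polynomial at $q=-1$. Binomial coefficients $\binom{a}{b}$ with $b>a$ are $0$. *)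

(* Defs.v *)
From HB Require Import structures.
From mathcomp Require Import all_boot all_order all_algebra.

Set Implicit Arguments.
Unset Strict Implicit.
Unset Printing Implicit Defensive.

Import Order.TTheory GRing.Theory Num.Theory.
Local Open Scope ring_scope.

(* A lattice path starting at the origin is the word of its steps:
   true is the up step U = (1,1) and false is the down step D = (1,-1). *)
Definition height (w : seq bool) (i : nat) : int :=
  (count_mem true (take i w))%:Z - (count_mem false (take i w))%:Z.

(* Ending at height 0 after n.*2 steps forces n up steps and n down steps. *)
Definition is_dyck (n : nat) (w : (n.*2).-tuple bool) : bool :=
  [forall i : 'I_(n.*2).+1, 0 <= height w i] && (height w n.*2 == 0).

Definition is_symmetric (n : nat) (w : (n.*2).-tuple bool) : bool :=
  [forall i : 'I_n.+1, height w i == height w (n.*2 - i)].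

Definition valleys (w : seq bool) : nat :=
  count (fun i => ~~ nth false w i && nth false w i.+1) (iota 0 (size w).-1).

Definition num_sym_dyck (n k : nat) : nat :=
  #|[set w : (n.*2).-tuple bool |
      [&& is_dyck w, is_symmetric w & valleys w == k]]|.

Section QAnalogues.
Variables (F : fieldType) (q : F).

Definition qint (m : nat) : F := (1 - q ^+ m) / (1 - q).

Definition qfact (m : nat) : F := \prod_(1 <= j < m.+1) qint j.

Definition qbinom (n k : nat) : F :=
  if (k <= n)%N then qfact n / (qfact k * qfact (n - k)) else 0.

Definition qNarayana (n k : nat) : F :=
  (qint k.+1)^-1 * qbinom n k * qbinom n.-1 k.

End QAnalogues.

(* P is the q-Narayana number N_{n,k} as a polynomial in the indeterminate q,
   the quotients being taken in the field Q(q) of rational functions. Since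
   {poly rat} embeds in its fraction field, at most one P qualifies. The detour
   is needed to evaluate at q = -1, where the q-integers of even index vanish. *)
Definition is_qNarayana_poly (n k : nat) (P : {poly rat}) : Prop :=
  tofrac P = qNarayana (tofrac 'X) n k.

(* Main.v *)
(* With m = n - 1, the q-Narayana number is the polynomial
     [m, k]^2 - q [m, k-1] [m, k+1],
   and at q = -1 the q-binomial [a, b] vanishes for a even and b odd and is
   the binomial of (a/2, b/2) otherwise, which gives the value v(n, k).

   A symmetric Dyck path is a ballot prefix of length n followed by its mirror
   image, so it has 2j + 1 or 2j valleys according to whether the prefix, with
   j valleys, ends with D or with U. Let A_n(j) count the prefixes ending with U
   and B_n(j) those ending with D. Appending a step gives
     A_(n+1)(j) = A_n(j) + B_n(j-1),
     B_(n+1)(j) = A_n(j) + B_n(j) - #(Dyck paths of length n with j valleys),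
   and the Narayana count of Dyck paths comes from the reflection-type closed
   formula for ballot words with prescribed numbers of U and D (nballot_upE). *)
Require Import Defs.
From mathcomp Require Import all_boot all_order all_algebra.
From mathcomp Require Import ring zify.
Import Order.TTheory GRing.Theory Num.Theory.
Local Open Scope ring_scope.

(* The binomial of (m, k - 1), read as 0 at k = 0. *)
Definition binp (m k : nat) : nat := if k is j.+1 then 'C(m, j) else 0.

Lemma binS_binp m k : 'C(m.+1, k) = ('C(m, k) + binp m k)%N.
Proof. by case: k => [|k]; rewrite ?bin0 ?addn0 ?binS. Qed.

(** * Gaussian polynomials and the q-Narayana numbers *)

Section Gauss.
Variable R : comNzRingType.
Implicit Type q : R.

(** The q-Pascal rule involves no division, so these make sense in any commutative ring, in
    particular at q = -1. *)
Fixpoint gauss q (n k : nat) : R :=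
  match n, k with
  | _, 0 => 1
  | 0, _.+1 => 0
  | m.+1, j.+1 => gauss q m j + q ^+ j.+1 * gauss q m j.+1
  end.

(* The shifted coefficient [n, k-1], read as 0 at k = 0. *)
Definition gaussp q (n k : nat) : R := if k is j.+1 then gauss q n j else 0.

Definition qnara q (m k : nat) : R :=
  gauss q m k ^+ 2 - q * (gaussp q m k * gauss q m k.+1).

Lemma gauss0 q n : gauss q n 0 = 1.
Proof. by case: n. Qed.

Lemma gaussSS q n k :
  gauss q n.+1 k.+1 = gauss q n k + q ^+ k.+1 * gauss q n k.+1.
Proof. by []. Qed.

Lemma gauss_small q n k : (n < k)%N -> gauss q n k = 0.
Proof.
elim: n k => [|n IH] [|k] //=; rewrite ltnS => lt_nk.
by rewrite !IH ?mulr0 ?addr0 // ltnW.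
Qed.

Lemma gaussnn q n : gauss q n n = 1.
Proof. by elim: n => //= n ->; rewrite gauss_small // mulr0 addr0. Qed.

(** At q = -1 the q-Pascal factor is a sign depending on the parity of the lower index. From an odd
    row, the two neighbours cancel or add by Pascal's rule; from an even row, one of them is 0. *)
Lemma gaussN1 n k :
  gauss (-1) n k = (if ~~ odd n && odd k then 0 else 'C(n./2, k./2))%:R.
Proof.
elim: n k => [|n IH] [|k]; rewrite ?gauss0 ?bin0 ?andbF //.
  by rewrite /=; case: k => [|k] //=; rewrite bin0n if_same.
rewrite gaussSS !IH -signr_odd /= !uphalf_half.
case: (odd n); case: (odd k) => //=;
  rewrite ?expr0 ?expr1 ?add0n ?add1n ?binS ?natrD; ring.
Qed.

(** For m even, one of the two terms of [qnara] vanishes; for m odd, they share a binomial factor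
    and Pascal's rule adds the cofactors. *)
Lemma qnaraN1 m k :
  qnara (-1) m k = ('C(m./2, k./2) * 'C(m.+1./2, k.+1./2))%:R.
Proof.
have gpE : gaussp (-1) m k
    = (if ~~ odd m && ~~ odd k then 0 else binp m./2 k.+1./2)%:R.
  case: k => [|k]; first by rewrite /= if_same.
  by rewrite /gaussp gaussN1 /= negbK.
rewrite /qnara gpE !gaussN1 /= !uphalf_half.
case: (odd m); case: (odd k) => //=;
  rewrite ?add0n ?add1n ?binS ?binS_binp ?natrM ?natrD //; ring.
Qed.

End Gauss.

Arguments gauss {R}.
Arguments gaussp {R}.
Arguments qnara {R}.

(** Applied both to the embedding of polynomials into fractions and to evaluation at a point. *)
Lemma rmorph_gauss (R S : comNzRingType) (f : {rmorphism R -> S}) q n k :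
  f (gauss q n k) = gauss (f q) n k.
Proof.
elim: n k => [|n IH] [|k] /=; rewrite ?rmorph1 ?rmorph0 //.
by rewrite rmorphD rmorphM rmorphXn !IH.
Qed.

Lemma rmorph_qnara (R S : comNzRingType) (f : {rmorphism R -> S}) q m k :
  f (qnara q m k) = qnara (f q) m k.
Proof.
rewrite /qnara rmorphB rmorphXn !rmorphM !rmorph_gauss.
by case: k => [|k] /=; rewrite ?rmorph0 ?rmorph_gauss.
Qed.

(** * q-binomials as quotients, for q not a root of unity *)

Section QField.
Variables (F : fieldType) (q : F).
Hypothesis qn1 : forall m, (0 < m)%N -> q ^+ m != 1.

Let q1 : 1 - q != 0.
Proof. by rewrite subr_eq0 eq_sym -[q]expr1 qn1. Qed.

Lemma qint_neq0 m : qint q m.+1 != 0.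
Proof. by rewrite mulf_neq0 ?invr_eq0 // subr_eq0 eq_sym qn1. Qed.

Lemma qfact0 : qfact q 0 = 1.
Proof. by rewrite /qfact big_nil. Qed.

Lemma qfactS m : qfact q m.+1 = qfact q m * qint q m.+1.
Proof. by rewrite /qfact big_nat_recr. Qed.

Lemma qfact_neq0 m : qfact q m != 0.
Proof.
by elim: m => [|m IH]; rewrite ?qfact0 ?oner_eq0 // qfactS mulf_neq0 ?qint_neq0.
Qed.

(** The quotients obey the q-Pascal rule because [a + b] = [a] + q^a [b]. *)
Lemma qbinom_gauss n k : qbinom q n k = gauss q n k.
Proof.
rewrite /qbinom.
elim: n k => [|n IH] [|k]; rewrite ?gauss0 ?leq0n ?subn0 ?qfact0 ?mul1r ?invr1
  ?divff ?qfact_neq0 ?oner_eq0 //.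
case: (ltnP k n.+1) => [lt_kn|lt_nk]; last by rewrite gauss_small.
rewrite gaussSS -!IH -ltnS lt_kn subSS; move: lt_kn; rewrite ltnS leq_eqVlt.
case: eqVneq => [-> _|_ /= lt_kn]; rewrite ?ltnn ?lt_kn.
  by rewrite mulr0 addr0 subnn qfact0 !mulr1 !divff ?qfact_neq0.
have [r ->] : exists r, n = (k + r).+1 by exists (n - k.+1)%N; lia.
have -> : ((k + r).+1 - k = r.+1)%N by lia.
have -> : ((k + r).+1 - k.+1 = r)%N by lia.
have : qint q (k + r).+2 = qint q k.+1 + q ^+ k.+1 * qint q r.+1.
  by rewrite /qint -addSn -addnS exprD; field.
rewrite (qfactS (k + r).+1) !(qfactS k) (qfactS r) => ->.
by field; rewrite !qint_neq0 !qfact_neq0.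
Qed.

Lemma qNarayanaS m k : qNarayana q m.+1 k = qnara q m k.
Proof.
rewrite /qNarayana /qnara [m.+1.-1]/=.
case: k => [|k].
  by rewrite !qbinom_gauss !gauss0 /qint expr1 /gaussp divff // invr1; ring.
have [lt_km|lt_mk|<-] := ltngtP k.+1 m.
- have [r ->] : exists r, m = (k.+2 + r)%N by exists (m - k.+2)%N; lia.
  rewrite /gaussp -!qbinom_gauss /qbinom.
  have -> : ((k.+2 + r) - k = r.+2)%N by lia.
  have -> : ((k.+2 + r) - k.+1 = r.+1)%N by lia.
  have -> : ((k.+2 + r) - k.+2 = r)%N by lia.
  have -> : ((k.+2 + r).+1 - k.+1 = r.+2)%N by lia.
  do !rewrite ifT; try lia.
  rewrite (qfactS (k.+2 + r)) (qfactS k.+1) (qfactS k) (qfactS r.+1) (qfactS r).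
  have := qfact_neq0 k; have := qfact_neq0 r; have := qfact_neq0 (k.+2 + r).
  have := qint_neq0 k; have := qint_neq0 k.+1.
  have := qint_neq0 r; have := qint_neq0 r.+1.
  (* What remains of the claim once the common q-factorials are cancelled. *)
  have : qint q (k.+2 + r).+1 = qint q r.+2 * qint q k.+2 - q * qint q k.+1 * qint q r.+1.
    rewrite /qint -addnS !exprD ![q ^+ _.+2]exprSr ![q ^+ _.+1]exprSr; field.
    exact: q1.
  move=> -> *; field; repeat (apply/andP; split); done.
- by rewrite [qbinom q m _]qbinom_gauss !gauss_small ?ltnS ?(ltnW lt_mk) //; ring.
- rewrite [qbinom q k.+1 _]qbinom_gauss [gauss _ _ k.+2]gauss_small // gaussnn.
  rewrite /qbinom leqnSn subSnn qfactS (qfactS 0) qfact0.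
  have -> : qint q 1 = 1 by rewrite /qint expr1 divff.
  rewrite -[qint q _]/(qint q k.+2).
  by field; rewrite qint_neq0 qfact_neq0.
Qed.

End QField.

Lemma tofracX_neq1 m : (0 < m)%N -> (tofrac 'X : {fraction {poly rat}}) ^+ m != 1.
Proof.
case: m => // m _; rewrite -rmorphXn -tofrac1 tofrac_eq.
by apply/eqP => /(congr1 (fun p : {poly rat} => size p)); rewrite size_polyXn size_poly1.
Qed.

Lemma qnara_poly m k : is_qNarayana_poly m.+1 k (qnara 'X m k).
Proof.
by rewrite /is_qNarayana_poly rmorph_qnara qNarayanaS //; exact: tofracX_neq1.
Qed.

Lemma qnara_eval m k (x : rat) : (qnara 'X m k).[x] = qnara x m k.
Proof. by rewrite -[LHS]/(horner_eval x _) rmorph_qnara /= /horner_eval hornerX. Qed.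

(** * Ballot prefixes by number of valleys *)

(** [P] lives on plain sequences, so that one predicate serves words of every length. *)
Definition npaths n (P : pred (seq bool)) : nat := #|[set v : n.-tuple bool | P v]|.

Lemma eq_npaths n (P Q : pred (seq bool)) :
  (forall v, size v = n -> P v = Q v) -> npaths n P = npaths n Q.
Proof. by move=> PQ; apply: eq_card => v; rewrite !inE PQ ?size_tuple. Qed.

Lemma npaths0 P : npaths 0 P = P [::].
Proof.
rewrite /npaths; case: (boolP (P [::])) => P0.
  rewrite (_ : [set v | _] = [set [tuple]]) ?cards1 //.
  by apply/setP => v; rewrite !inE tuple0 eqxx.
by apply/eqP; rewrite cards_eq0; apply/eqP/setP => v; rewrite !inE tuple0 (negbTE P0).
Qed.

Lemma npathsS n P :
  npaths n.+1 P = (npaths n (fun v => P (true :: v)) + npaths n (fun v => P (false :: v)))%N.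
Proof.
pose c b (v : n.-tuple bool) := [tuple of b :: v].
have c_inj b : injective (c b).
  by move=> u v /(congr1 val) [uv]; exact: val_inj.
rewrite /npaths -(card_imset _ (c_inj true)) -(card_imset _ (c_inj false)).
rewrite -cardsUI -[LHS]addn0; congr (_ + _)%N.
  apply: eq_card => v; rewrite inE; case/tupleP: v => b v.
  rewrite !inE; apply/idP/orP => [Pv|[] /imsetP[u]].
  - case: b Pv => Pv; [left | right]; apply/imsetP; exists v;
      by [rewrite inE | apply: val_inj].
  - by rewrite inE => Pu ->.
  - by rewrite inE => Pu ->.
apply/esym/eqP; rewrite cards_eq0 -subset0; apply/subsetP => v.
by rewrite inE => /andP[/imsetP[u _ ->] /imsetP[u' _ /(congr1 val)]].
Qed.

Lemma npathsD n (Q P : pred (seq bool)) :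
  npaths n P = (npaths n (predI P Q) + npaths n (predI P (predC Q)))%N.
Proof.
rewrite /npaths -(cardsID [set v : n.-tuple bool | Q v]).
by congr (_ + _)%N; apply: eq_card => v; rewrite !inE //= andbC.
Qed.

Lemma npaths_pred0 n (P : pred (seq bool)) :
  (forall v, size v = n -> P v = false) -> npaths n P = 0%N.
Proof.
move=> P0; apply/eqP; rewrite cards_eq0; apply/eqP/setP => v.
by rewrite !inE P0 ?size_tuple.
Qed.

(* From here on a prefix of a path is stored backwards, its last step first, so
   that appending a step is a cons and [head true v] is the last step. The empty
   prefix counts as ending with U. *)
Fixpoint ballot (v : seq bool) : bool :=
  if v is b :: v' then
    ballot v' && (b || (count_mem false v' < count_mem true v')%N)
  else true.

Fixpoint rvalleys (v : seq bool) : nat :=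
  if v is b :: v' then (rvalleys v' + (b && ~~ head true v'))%N else 0.

Definition ballot_stat (b : bool) (j : nat) : pred (seq bool) :=
  fun v => [&& ballot v, head true v == b & rvalleys v == j].

Definition ballot_upstat b u j : pred (seq bool) :=
  fun v => ballot_stat b j v && (count_mem true v == u).

Definition nballot b n j := npaths n (ballot_stat b j).

Definition nballot_up b u d j := npaths (u + d) (ballot_upstat b u j).

(* Counts with one valley less, read as 0 at j = 0. *)
Definition nballotp n j := if j is i.+1 then nballot false n i else 0%N.
Definition nballot_upp u d j := if j is i.+1 then nballot_up false u d i else 0%N.

(** * Ballot prefixes with prescribed numbers of U and D *)

Lemma count_downs {n u} v : size v = n -> count_mem true v = u ->
  count_mem false v = (n - u)%N.
Proof.
move=> <- <-; rewrite -(count_predC (pred1 true) v) addKn.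
by apply: eq_count => -[].
Qed.

Lemma ballot_ge v : ballot v -> (count_mem false v <= count_mem true v)%N.
Proof. by elim: v => //= -[] v IH /andP[/IH]; lia. Qed.

(** A final U is always allowed, and creates a valley exactly when it follows a D. *)
Lemma nballot_up_true u d j :
  nballot_up true u.+1 d j = (nballot_up true u d j + nballot_upp u d j)%N.
Proof.
rewrite /nballot_up addSn npathsS [X in (_ + X)%N]npaths_pred0 ?addn0; last first.
  by move=> v _; rewrite /ballot_upstat /ballot_stat /= andbF.
rewrite (npathsD _ (head true)); congr (_ + _)%N.
  apply: eq_npaths => v _; rewrite /= /ballot_upstat /ballot_stat /= andbT.
  by case: head; rewrite /= ?addn0 ?eqSS ?andbT ?andbF // add1n eqSS.
case: j => [|j].
  apply: npaths_pred0 => v _; rewrite /= /ballot_upstat /ballot_stat /=.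
  by case: head; rewrite /= ?andbF // addn1 /= !andbF.
apply: eq_npaths => v _; rewrite /= /ballot_upstat /ballot_stat /= andbT.
by case: head; rewrite /= ?andbF // addn1 add1n !eqSS !andbT.
Qed.

(** Since d < u, a D may follow every such prefix; it never creates a valley. *)
Lemma nballot_up_false u d j : (d < u)%N ->
  nballot_up false u d.+1 j = (nballot_up true u d j + nballot_up false u d j)%N.
Proof.
move=> lt_du; rewrite /nballot_up addnS npathsS npaths_pred0 ?add0n; last first.
  by move=> v _; rewrite /ballot_upstat /ballot_stat /= andbF.
rewrite (npathsD _ (head true)); congr (_ + _)%N;
  apply: eq_npaths => v size_v; rewrite /= /ballot_upstat /ballot_stat /= addn0 add0n;
  (have [cu|] := eqVneq (count_mem true v) u; last by rewrite !andbF);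
  rewrite (count_downs _ size_v cu) cu addKn lt_du andbT;
  by case: head; rewrite /= ?andbF ?andbT.
Qed.

Lemma nballot_up_lt b u d j : (u < d)%N -> nballot_up b u d j = 0%N.
Proof.
move=> lt_ud; apply: npaths_pred0 => v size_v; rewrite /ballot_upstat /ballot_stat.
apply/negP => /andP[/and3P[/ballot_ge le_du _ _]] /eqP cu.
by move: le_du; rewrite (count_downs _ size_v cu) cu; lia.
Qed.

Lemma nballot_up_nodown u j :
  nballot_up true u 0 j = (j == 0)%N /\ nballot_up false u 0 j = 0%N.
Proof.
elim: u j => [|u IH] j.
  by rewrite /nballot_up !npaths0 /ballot_upstat /ballot_stat /= andbT eq_sym.
split; last first.
  apply: npaths_pred0 => v size_v; rewrite /ballot_upstat /ballot_stat.
  apply/negP => /andP[/and3P[_ hv _]] /eqP cu.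
  have := count_downs _ size_v cu; rewrite addn0 subnn.
  by case: v hv {size_v cu} => [|[] v].
rewrite nballot_up_true (IH j).1; case: j => [|j] //=.
by rewrite (IH j).2.
Qed.

(** Each count is a difference of two products of binomials, written additively to avoid truncated
    subtraction. The induction is on u + d because one recursion lowers u and the other lowers d. *)
Lemma nballot_upE u d j : (d <= u)%N ->
  (nballot_up true u.+1 d.+1 j + binp u j * 'C(d, j) = 'C(u, j) * binp d j)%N /\
  (nballot_up false u.+1 d.+1 j + binp u j * 'C(d, j.+1) = 'C(u, j) * 'C(d, j))%N.
Proof.
have [n le_n] := ubnP (u + d)%N; elim: n u d j le_n => // n IH u d j le_n le_du.
split; last first.
  case: d => [|d] in le_n le_du *.
    rewrite nballot_up_false // (nballot_up_nodown _ _).1 (nballot_up_nodown _ _).2.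
    by rewrite !bin0n; case: j => [|j]; rewrite ?bin0 ?muln0.
  have [||HE HF] := IH u d j; [lia|lia|].
  rewrite nballot_up_false // binS [X in _ = (_ * X)%N]binS_binp; nia.
rewrite nballot_up_true; case: u => [|u] in le_n le_du *.
  rewrite nballot_up_lt //; case: j => [|j] //=.
  by rewrite nballot_up_lt //; case: d j le_du le_n => [|d] [].
have [le_du'|lt_ud] := leqP d u.
  have [||HE HF] := IH u d j; [lia|lia|].
  case: j => [|j] /= in HE HF *; first by lia.
  have [||_ HF'] := IH u d j; [lia|lia|].
  rewrite binS binS_binp; nia.
(* At this boundary the shorter prefixes would have more D than U, so their counts are 0, and the
   two products coincide. *)
have -> : d = u.+1 by lia.
by rewrite nballot_up_lt //; case: j => [|j] //=; rewrite ?nballot_up_lt // mulnC.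
Qed.

(** * Ballot prefixes of prescribed length *)

Lemma nballot_true n j :
  nballot true n.+1 j = (nballot true n j + nballotp n j)%N.
Proof.
rewrite /nballot npathsS [X in (_ + X)%N]npaths_pred0 ?addn0; last first.
  by move=> v _; rewrite /ballot_stat /= andbF.
rewrite (npathsD _ (head true)); congr (_ + _)%N.
  apply: eq_npaths => v _; rewrite /= /ballot_stat /= andbT.
  by case: head; rewrite /= ?addn0 ?andbT ?andbF.
case: j => [|j].
  apply: npaths_pred0 => v _; rewrite /= /ballot_stat /=.
  by case: head; rewrite /= ?andbF // addn1 /= !andbF.
apply: eq_npaths => v _; rewrite /= /ballot_stat /= andbT.
by case: head; rewrite /= ?andbF // addn1 eqSS !andbT.
Qed.

(** A D may follow any prefix except those ending on the axis, which the [npaths] term restores. *)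
Lemma nballot_false n j :
  (nballot false n.+1 j
   + npaths n (fun v => [&& ballot v, rvalleys v == j
                          & count_mem true v == count_mem false v])
   = nballot true n j + nballot false n j)%N.
Proof.
pose P v := ballot v && (rvalleys v == j).
have -> : (nballot true n j + nballot false n j = npaths n P)%N.
  rewrite (npathsD n (head true) P); congr (_ + _)%N; apply: eq_npaths => v _;
    by rewrite /= /ballot_stat /P; case: head; rewrite /= ?andbT ?andbF.
rewrite (npathsD n (fun v => count_mem false v < count_mem true v)%N P).
rewrite /nballot npathsS npaths_pred0 ?add0n; last first.
  by move=> v _; rewrite /ballot_stat /= andbF.
congr (_ + _)%N; apply: eq_npaths => v _; rewrite /= /ballot_stat /P /=.
  by rewrite addn0 -!andbA; congr (_ && _); rewrite andbC.
rewrite -leqNgt -andbA; case: (boolP (ballot v)) => //= /ballot_ge le_du.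
by rewrite [count_mem _ _ == _]eqn_leq le_du andbT.
Qed.

(** By parity, no prefix of odd length ends on the axis. *)
Lemma nballot_false_odd h j :
  nballot false h.*2.+2 j = (nballot true h.*2.+1 j + nballot false h.*2.+1 j)%N.
Proof.
rewrite -nballot_false [X in (_ + X)%N]npaths_pred0 ?addn0 // => v size_v.
apply/negP => /and3P[_ _ /eqP cv].
have := count_downs v size_v erefl; rewrite -cv.
have := count_size (pred1 true) v; rewrite size_v; lia.
Qed.

(** The excluded prefixes are the Dyck paths of semi-length h, split by last step; only the empty
    one counts as ending with U. *)
Lemma nballot_false_even h j :
  (nballot false (h + h).+1 j + (nballot_up true h h j + nballot_up false h h j)
   = nballot true (h + h) j + nballot false (h + h) j)%N.
Proof.
have midE v : size v = (h + h)%N ->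
    (count_mem true v == count_mem false v) = (count_mem true v == h).
  move=> size_v; have := count_downs v size_v erefl.
  by have := count_size (pred1 true) v; lia.
rewrite -nballot_false; congr (_ + _)%N.
rewrite [RHS](npathsD _ (head true)); congr (_ + _)%N;
  apply: eq_npaths => v size_v; rewrite /= /ballot_upstat /ballot_stat midE //;
  by case: head; rewrite /= ?andbT ?andbF -?andbA.
Qed.

(** Induction along lengths 2h+1, 2h+2, 2h+3. Only the passage from even to odd length has to
    discard prefixes ending on the axis. *)
Lemma nballotE h j :
  [/\ nballot true h.*2.+1 j = 'C(h, j) * 'C(h, j),
      nballot false h.*2.+1 j = 'C(h, j) * 'C(h, j.+1),
      nballot true h.*2.+2 j = 'C(h, j) * 'C(h.+1, j) &
      nballot false h.*2.+2 j = 'C(h, j) * 'C(h.+1, j.+1)]%N.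
Proof.
have even_of_odd h' :
    (forall i, nballot true h'.*2.+1 i = 'C(h', i) * 'C(h', i) /\
               nballot false h'.*2.+1 i = 'C(h', i) * 'C(h', i.+1))%N ->
    forall i, (nballot true h'.*2.+2 i = 'C(h', i) * 'C(h'.+1, i) /\
               nballot false h'.*2.+2 i = 'C(h', i) * 'C(h'.+1, i.+1))%N.
  move=> odd_h i; rewrite nballot_true nballot_false_odd !(odd_h i).1 !(odd_h i).2.
  split; last by rewrite binS; lia.
  by case: i => [|i]; rewrite /nballotp ?(odd_h i).2 ?binS ?bin0 //; lia.
have odd_h i : (nballot true h.*2.+1 i = 'C(h, i) * 'C(h, i) /\
               nballot false h.*2.+1 i = 'C(h, i) * 'C(h, i.+1))%N.
  elim: h i => [|h IH] i.
    have base b k : nballot b 0 k = (b && (k == 0))%N.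
      by rewrite /nballot npaths0 /ballot_stat /=; case: b; rewrite eq_sym.
    have := nballot_false_even 0 i.
    rewrite -[double 0]/(0 + 0)%N nballot_true /nballotp.
    rewrite (nballot_up_nodown _ _).1 (nballot_up_nodown _ _).2 !base !bin0n.
    by case: i => [|i] /=; rewrite ?base; lia.
  have ev := even_of_odd _ IH.
  have := nballot_false_even h.+1 i; rewrite addnn doubleS.
  (* With u = d = h this yields the Narayana number C(h,i)^2 - C(h,i-1) C(h,i+1) of discarded
     prefixes. *)
  have [HE HF] := nballot_upE h h i (leqnn h).
  rewrite (ev i).1 (ev i).2 nballot_true (ev i).1 => HB; split.
    by case: i {HE HF HB} => [|i]; rewrite /nballotp ?(ev i).2 ?binS ?bin0; nia.
  by move: HB HE HF; rewrite binS binS_binp; nia.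
by have [? ?] := odd_h j; have [? ?] := even_of_odd h odd_h j.
Qed.

(** * Symmetric Dyck paths as mirrored prefixes *)

(** As [v] is stored backwards, [rev v] is the left half. Its mirror image reverses the order and
    swaps U and D, hence is [map negb v]. *)
Definition sympath (v : seq bool) : seq bool := rev v ++ map negb v.

Lemma count_negb b v : count_mem b (map negb v) = count_mem (~~ b) v.
Proof. by rewrite count_map; apply: eq_count => -[]; case: b. Qed.

Lemma nth_sympathC v i : (i < size v)%N ->
  nth false (sympath v) ((size v).*2 - i.+1) = ~~ nth false (sympath v) i.
Proof.
move=> lt_iv; rewrite /sympath !nth_cat size_rev lt_iv ifF; last by lia.
rewrite (nth_map false) ?nth_rev //; last by lia.
by congr (~~ nth _ _ _); lia.
Qed.

Lemma heightS w i : (i < size w)%N ->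
  height w i.+1 = height w i + (if nth false w i then 1 else - 1).
Proof.
move=> lt_iw; rewrite /height (take_nth false) // -cats1 !count_cat /=.
by case: nth => /=; lia.
Qed.

(** Induction inwards from the two ends: both are at height 0, and mirrored steps are opposite. *)
Lemma height_sympathC v i : (i <= size v)%N ->
  height (sympath v) ((size v).*2 - i) = height (sympath v) i.
Proof.
have size_s : size (sympath v) = (size v).*2.
  by rewrite size_cat size_rev size_map addnn.
elim: i => [|i IH] lt_iv.
  rewrite subn0 -size_s /height take_size take0 /= /sympath !count_cat !count_negb.
  by rewrite !count_rev /=; lia.
have := IH (ltnW lt_iv).
have -> : ((size v).*2 - i = ((size v).*2 - i.+1).+1)%N by lia.
rewrite !heightS ?size_s ?nth_sympathC; try lia.
by case: nth => /=; lia.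
Qed.

Lemma symmetric_sympath n (w : (n.*2).-tuple bool) :
  is_symmetric w -> val w = sympath (rev (take n w)).
Proof.
move=> /forallP sym_w; have size_w := size_tuple w.
rewrite /sympath revK; apply: (etrans (esym (cat_take_drop n w))); congr (_ ++ _).
have size_t : size (take n w) = n by rewrite size_takel // size_w; lia.
apply: (@eq_from_nth _ false) => [|j].
  by rewrite size_drop size_map size_rev size_t size_w; lia.
rewrite size_drop size_w => lt_jn.
have {}lt_jn : (j < n)%N by lia.
rewrite nth_drop (nth_map false) ?size_rev ?size_t // nth_rev ?size_t //.
rewrite nth_take; last by lia.
set i := (n - j.+1)%N.
have sym_i m : (m <= n)%N -> height w m = height w (n.*2 - m).
  by rewrite -ltnS => lt_mn; apply/eqP; have := sym_w (Ordinal lt_mn).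
(* Comparing the symmetry at two consecutive abscissas forces the mirrored steps, at positions i and
   n + j, to be opposite. *)
have := sym_i i.+1; have := sym_i i.
have -> : (n.*2 - i = (n + j).+1)%N by rewrite /i; lia.
have -> : (n.*2 - i.+1 = n + j)%N by rewrite /i; lia.
rewrite !heightS ?size_w; try by rewrite /i; lia.
move=> /(_ ltac:(rewrite /i; lia)) -> /(_ ltac:(rewrite /i; lia)).
by case: nth; case: nth => //=; lia.
Qed.

Lemma height_rev v : height v (size v) = height (rev v) (size v).
Proof. by rewrite -{2}(size_rev v) /height !take_size !count_rev. Qed.

Lemma ballotP v :
  reflect (forall i, (i <= size v)%N -> 0 <= height (rev v) i) (ballot v).
Proof.
elim: v => [|b v IH]; first by apply: ReflectT => i; rewrite /height.
have height_lt i : (i <= size v)%N -> height (rev (b :: v)) i = height (rev v) i.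
  by move=> le_iv; rewrite /height rev_cons -cats1 takel_cat ?size_rev.
have height_last : height (rev (b :: v)) (size v).+1
    = (b + count_mem true v)%N%:Z - (~~ b + count_mem false v)%N%:Z.
  rewrite -[_.+1]/(size (b :: v)) -height_rev /height take_size /=.
  by clear; case: b.
apply: (iffP andP) => [[bal_v step] i|H].
  rewrite leq_eqVlt ltnS => /predU1P[->|le_iv]; last first.
    by rewrite height_lt // (IH bal_v).
  by rewrite height_last; have := ballot_ge v bal_v; move: step; clear; case: b => /=; lia.
split; first by apply/IH => i le_iv; rewrite -height_lt // H // ltnW.
by have := H _ (leqnn _); rewrite height_last; clear; case: b => /=; lia.
Qed.

Lemma valleys_cons a s : valleys (a :: s) = ((~~ a && head false s) + valleys s)%N.
Proof.
case: s => [|b s]; rewrite /valleys /= ?andbF //; congr (_ + _)%N.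
by rewrite (iotaDl 1 0) count_map.
Qed.

Lemma valleys_cat s1 s2 :
  valleys (s1 ++ s2)
  = (valleys s1 + valleys s2 + (~~ last true s1 && head false s2))%N.
Proof.
elim: s1 => [|a s1 IH] /=; first by rewrite add0n addn0.
rewrite !valleys_cons IH; case: s1 {IH} => [|b s1] /=; last by lia.
by rewrite andbF; lia.
Qed.

Lemma valleys_rev v : valleys (rev v) = rvalleys v.
Proof.
elim: v => //= b v IH; rewrite rev_cons -cats1 valleys_cat IH valleys_cons /=.
rewrite andbF addn0 andbC; congr (_ + _)%N; congr (nat_of_bool (_ && ~~ _)).
by case: v {IH} => //= c v; rewrite rev_cons last_rcons.
Qed.

Lemma valleys_negb v : valleys (map negb v) = rvalleys v.
Proof.
elim: v => //= b v IH; rewrite valleys_cons IH negbK addnC.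
by case: v {IH}.
Qed.

(** The midpoint is a valley exactly when the left half ends with D, since the right half then
    starts with U. *)
Lemma valleys_sympath v :
  valleys (sympath v) = ((rvalleys v).*2 + ~~ head true v)%N.
Proof.
rewrite valleys_cat valleys_rev valleys_negb addnn; congr (_ + _)%N.
by case: v => //= c v; rewrite rev_cons last_rcons andbb.
Qed.

Lemma num_sym_dyckE n k :
  num_sym_dyck n k =
  npaths n (fun v => ballot v && ((rvalleys v).*2 + ~~ head true v == k))%N.
Proof.
have size_s (v : n.-tuple bool) : size (sympath v) == n.*2.
  by rewrite size_cat size_rev size_map size_tuple addnn.
pose f v : (n.*2).-tuple bool := Tuple (size_s v).
have f_inj : injective f.
  move=> u v /(congr1 (fun w => rev (take n (val w)))) /=.
  rewrite /sympath !take_size_cat ?size_rev ?size_tuple // !revK.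
  exact: val_inj.
rewrite /npaths -(card_imset _ f_inj); apply: eq_card => w; rewrite !inE.
(* The right half repeats the heights of the left half, so nonnegativity need only be checked up to
   n. *)
have dyck_f v : is_dyck (f v) = ballot v.
  have size_v := size_tuple v.
  have height_f i : (i <= n)%N -> height (f v) i = height (rev v) i.
    by move=> le_in; rewrite /height takel_cat // size_rev size_v.
  have heightC i : (i <= n)%N -> height (f v) (n.*2 - i) = height (rev v) i.
    move=> le_in; rewrite -height_f //.
    by have := @height_sympathC v i; rewrite size_v => /(_ le_in).
  apply/andP/ballotP => [[/forallP H _] i|H].
    rewrite size_v => le_in; rewrite -height_f //.
    have lt_i : (i < n.*2.+1)%N by lia.
    exact: (H (Ordinal lt_i)).
  rewrite size_v in H; split; last first.
    by have := heightC 0 (leq0n n); rewrite subn0 => ->; rewrite /height take0.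
  apply/forallP => -[i /= lt_i]; have [le_in|lt_ni] := leqP i n.
    by rewrite height_f // H.
  have -> : i = (n.*2 - (n.*2 - i))%N by lia.
  by rewrite heightC ?H //; lia.
apply/and3P/imsetP => [[dyck_w sym_w val_w]|[v]].
  have size_r : size (rev (take n w)) == n.
    by rewrite size_rev size_takel // size_tuple; lia.
  have def_w : w = f (Tuple size_r) by apply: val_inj; exact: symmetric_sympath.
  exists (Tuple size_r) => //; rewrite inE -dyck_f -def_w dyck_w.
  by rewrite -valleys_sympath -[sympath _]/(val (f (Tuple size_r))) -def_w.
rewrite inE -dyck_f -valleys_sympath => /andP[dyck_v val_v] ->; split => //.
apply/forallP => -[i /= lt_i].
by have := @height_sympathC v i; rewrite size_tuple => ->.
Qed.

(** The parity of k determines the last step of the prefix, and [k./2] its number of valleys. *)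
Lemma num_sym_dyck_nballot n k : num_sym_dyck n k = nballot (~~ odd k) n k./2.
Proof.
rewrite num_sym_dyckE; apply: eq_npaths => v _; rewrite /ballot_stat.
congr (_ && _); rewrite -[k in LHS]odd_double_half.
by case: head; case: (odd k) => /=; apply/eqP/eqP; lia.
Qed.

Lemma num_sym_dyck_bin n k :
  num_sym_dyck n.+1 k = ('C(n./2, k./2) * 'C(n.+1./2, k.+1./2))%N.
Proof.
rewrite num_sym_dyck_nballot -[n in LHS]odd_double_half /= !uphalf_half.
have [A B A' B'] := nballotE n./2 k./2.
by case: (odd n); case: (odd k); rewrite ?add0n ?add1n.
Qed.

Theorem theorem1 (n k : nat) (hn : (1 <= n)%N) :
  exists2 N : {poly rat}, is_qNarayana_poly n k N &
    (num_sym_dyck n k)%:R = N.[-1] /\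
    N.[-1] = ('C((n - 1)./2, k./2) * 'C(n./2, (k + 1)./2))%:R.
Proof.
case: n hn => // m _; exists (qnara 'X m k); first exact: qnara_poly.
by rewrite qnara_eval qnaraN1 num_sym_dyck_bin subn1 addn1.
Qed.
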